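(* Let $q$ be a real number with $q\neq 0,\pm 1$, and let $n$ be a positive integer. Then, for each real function $f$ and each point $x\in\mathbb{R}$: (i) both $f_{(n-1)}(x)$ and one of ${_q}D_nf(x)$ or ${_q}\bar D_nf(x)$ exist if and only if $f_{(n)}(x)$ exists; (ii) both $f_{(n-2)}^s(x)$ and ${_q}D_n^sf(x)$ exist if and only if $f_{(n)}^s(x)$ exists, where for $n=1$ the condition on $f_{(n-2)}^s(x)$ is omitted (that is, for $n=1$: ${_q}D_1^sf(x)$ exists if and only if $f_{(1)}^s(x)$ exists).
   Context: Functions $f$ are real-valued functions of a real variable. All derivatives are finite real numbers. Generalized Riemann derivatives. An $n$-th generalized Riemann difference is $\Delta_{\mathcal{A}}(x,h;f)=\sum_{k=0}^{\ell}A_kf(x+a_kh)$, where the real numbers $A_k$ are non-zero, the real numbers $a_k$ are distinct, and $\sum_{k=0}^{\ell}A_ka_k^j=\delta_{j,n}\cdot n!$ for $j=0,1,\ldots ,n$ (with $0^0=1$). The points $x+a_kh$ are its base points. The associated $n$-th generalized Riemann derivative is $D_{\mathcal{A}}f(x)=\lim_{h\to 0}\Delta_{\mathcal{A}}(x,h;f)/h^n$, when this limit exists. When there are exactly $n+1$ base points ($\ell=n$; ''without excess''), the coefficients $A_k$ are uniquely determined by the $a_k$. For real $q\neq 0,\pm1$: - ${_q}D_nf(x)$ is the $n$-th generalized Riemann derivative based at $x,x+h,x+qh,x+q^2h,\ldots ,x+q^{n-1}h$; - ${_q}\bar D_nf(x)$ is the $n$-th generalized Riemann derivative based at $x+h,x+qh,x+q^2h,\ldots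 ,x+q^{n}h$; - ${_q}D_n^sf(x)$ is the $n$-th generalized Riemann derivative based at $x\pm h,x\pm qh,\ldots ,x\pm q^{m-1}h$, together with $x$ when $n$ is even, where $m=\lfloor (n+1)/2\rfloor$. All of these are without excess. Peano derivatives. $f$ has $n$ Peano derivatives at $x$ (equivalently, $f_{(n)}(x)$ exists) if there are real numbers $f_{(0)}(x):=f(x),f_{(1)}(x),\ldots ,f_{(n)}(x)$ such that $f(x+h)=\sum_{i=0}^n f_{(i)}(x)\frac{h^i}{i!}+o(h^n)$ as $h\to 0$. For $n=0$ this means that $f$ is continuous at $x$. Symmetric Peano derivatives. $f$ has $n$ symmetric Peano derivatives at $x$ (equivalently, $f_{(n)}^s(x)$ exists) if there are real numbers $f_{(0)}^s(x),\ldots ,f_{(n)}^s(x)$, with $f_{(0)}^s(x)=f(x)$ when $n$ is even, such that $\frac12\{f(x+h)+(-1)^nf(x-h)\}=\sum_{i=0}^n f_{(i)}^s(x)\frac{h^i}{i!}+o(h^n)$ as $h\to 0$. *)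

(* Defs.v *)
From HB Require Import structures.
From mathcomp Require Import all_boot all_order all_algebra.
From mathcomp Require Import all_classical all_reals all_analysis.
Set Implicit Arguments.
Unset Strict Implicit.
Unset Printing Implicit Defensive.
Import Order.TTheory GRing.Theory Num.Theory.
Import numFieldNormedType.Exports.
Local Open Scope classical_set_scope.
Local Open Scope ring_scope.

(* The coefficients [A k] and nodes [a k] define an [n]-th generalized Riemann
   difference.  Here [l] is the number of base points; since [0 ^+ 0 = 1], the
   usual convention holds for [j = 0]. *)
Definition gr_difference_data (R : realType) (n l : nat) (A a : 'I_l -> R)
  : Prop :=
  [/\ forall k, A k != 0,
      injective a
    & forall j : nat, (j <= n)%N ->
        \sum_(k < l) A k * a k ^+ j = (j == n)%:R * n`!%:R].

Definition gr_difference (R : realType) (l : nat) (A a : 'I_l -> R)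
  (x h : R) (f : R -> R) : R :=
  \sum_(k < l) A k * f (x + a k * h).

Definition gr_derivable (R : realType) (n l : nat) (A a : 'I_l -> R)
  (f : R -> R) (x : R) : Prop :=
  cvg (gr_difference A a x h f / h ^+ n @[h --> (0 : R)^']).

(* The [n]-th generalized Riemann derivative based at the points [x + b * h],
   for [b] in [s], exists.  When [s] consists of [n + 1] distinct reals, the
   coefficients [A] are uniquely determined by [s]. *)
Definition gr_derivable_at_nodes (R : realType) (n : nat) (s : seq R)
  (f : R -> R) (x : R) : Prop :=
  let a := fun k : 'I_(size s) => s`_k in
  exists A : 'I_(size s) -> R,
    gr_difference_data n A a /\ gr_derivable n A a f x.

Definition qD_nodes (R : realType) (q : R) (n : nat) : seq R :=
  0 :: [seq q ^+ i | i <- iota 0 n].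

Definition qDbar_nodes (R : realType) (q : R) (n : nat) : seq R :=
  [seq q ^+ i | i <- iota 0 n.+1].

Definition qDs_nodes (R : realType) (q : R) (n : nat) : seq R :=
  let m := (n.+1)./2 in
  (if odd n then [::] else [:: 0])
    ++ [seq q ^+ i | i <- iota 0 m] ++ [seq - q ^+ i | i <- iota 0 m].

Definition qD_exists (R : realType) (q : R) (n : nat) (f : R -> R) (x : R)
  : Prop := gr_derivable_at_nodes n (qD_nodes q n) f x.

Definition qDbar_exists (R : realType) (q : R) (n : nat) (f : R -> R) (x : R)
  : Prop := gr_derivable_at_nodes n (qDbar_nodes q n) f x.

Definition qDs_exists (R : realType) (q : R) (n : nat) (f : R -> R) (x : R)
  : Prop := gr_derivable_at_nodes n (qDs_nodes q n) f x.

Definition peano_exists (R : realType) (n : nat) (f : R -> R) (x : R) : Prop :=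
  exists c : 'I_n.+1 -> R,
    c ord0 = f x /\
    (fun h : R => f (x + h) - \sum_(i < n.+1) c i * (h ^+ i / i`!%:R))
      =o_ (0 : R) (fun h : R => h ^+ n).

Definition sym_peano_exists (R : realType) (n : nat) (f : R -> R) (x : R)
  : Prop :=
  exists c : 'I_n.+1 -> R,
    (~~ odd n -> c ord0 = f x) /\
    (fun h : R => 2^-1 * (f (x + h) + (-1) ^+ n * f (x - h))
                  - \sum_(i < n.+1) c i * (h ^+ i / i`!%:R))
      =o_ (0 : R) (fun h : R => h ^+ n).

(* Main.v *)
Require Import Defs.
From mathcomp Require Import all_boot all_order all_algebra.
From mathcomp Require Import all_classical all_reals all_analysis.
From mathcomp Require Import ring lra zify.
Set Implicit Arguments.
Unset Strict Implicit.
Unset Printing Implicit Defensive.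
Import Order.TTheory GRing.Theory Num.Theory.
Import numFieldNormedType.Exports.
Local Open Scope classical_set_scope.
Local Open Scope ring_scope.

(* Let [T] be the dilation [T g h = g (q h)].  Subtracting a polynomial from the
   given expansion leaves [g = o(h^(n-1))] whose [n]-th difference is [o(h^n)].
   Since the difference annihilates [h^j] for [j < n], it is a polynomial in [T]
   with the known simple roots [q^j], so it factors as a constant times a product
   of [T - q^j].  Each factor can be removed: if [u = o(h^j)] with [j < n] and
   [(T - q^j) u = o(h^n)], then [u = o(h^n)], by summing a geometric series along
   [h, q h, q^2 h, ...] (with [q^-1] in place of [q] when [|q| > 1]).

   In the symmetric case the weights of opposite nodes differ by the factor
   [(-1)^n], so [f] may be replaced by its part of the parity of [n]; then only
   the exponents [j] of that parity occur, and [o(h^(n-2))] suffices. *)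

(** * Little-o calculus and removal of a single dilation factor *)

(** The bound is also imposed at [h = 0], so it forces [g 0 = 0], even for [n = 0]. *)
Definition little_o (R : realType) (n : nat) (g : R -> R) : Prop :=
  forall e : R, 0 < e ->
    exists2 d, 0 < d & forall h, `|h| < d -> `|g h| <= e * `|h| ^+ n.

Lemma eqo_little_o (R : realType) (n : nat) (g : R -> R) :
  (g =o_ (0 : R) (fun h : R => h ^+ n)) <-> little_o n g.
Proof.
split=> [/eqoP H e e0|H].
  have : \forall h \near (0 : R), `|g h| <= e * `|h ^+ n| by exact: H.
  move=> /nbhs_norm0P [d /= d0 Hd].
  by exists d => // h hd; rewrite -normrX; apply: Hd.
apply/eqoP => e e0; have [d d0 Hd] := H _ e0.
suff : \forall h \near (0 : R), `|g h| <= e * `|h ^+ n| by [].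
apply/nbhs_norm0P; exists d => //= h hd; rewrite normrX; exact: Hd.
Qed.

Lemma eq_little_o (R : realType) (n : nat) (g1 g2 : R -> R) :
  g1 =1 g2 -> little_o n g1 -> little_o n g2.
Proof.
move=> E H e /H [d d0 Hd]; exists d => // h /Hd; by rewrite E.
Qed.

Lemma little_o_at0 (R : realType) (n : nat) (g : R -> R) :
  little_o n g -> g 0 = 0.
Proof.
move=> H; apply/eqP; rewrite -normr_le0; apply/ler_addgt0Pr => e e0.
have [d d0 /(_ 0)] := H _ e0; rewrite normr0 add0r => /(_ d0) /le_trans; apply.
by rewrite ler_piMr ?(ltW e0)// expr0n; case: n {H}.
Qed.

Lemma little_o0 (R : realType) (n : nat) : little_o n (fun _ : R => 0).
Proof.
by move=> e e0; exists 1 => // h _; rewrite normr0 mulr_ge0 ?exprn_ge0 ?(ltW e0).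
Qed.

Lemma little_oD (R : realType) (n : nat) (g1 g2 : R -> R) :
  little_o n g1 -> little_o n g2 -> little_o n (fun h => g1 h + g2 h).
Proof.
move=> H1 H2 e e0; have e20 : 0 < e / 2 by rewrite divr_gt0.
have [d1 d10 Hd1] := H1 _ e20; have [d2 d20 Hd2] := H2 _ e20.
exists (Num.min d1 d2); first by rewrite lt_min d10.
move=> h; rewrite lt_min => /andP[/Hd1 h1 /Hd2 h2].
by apply: (le_trans (ler_normD _ _)); move: h1 h2; lra.
Qed.

Lemma little_oZ (R : realType) (n : nat) (c : R) (g : R -> R) :
  little_o n g -> little_o n (fun h => c * g h).
Proof.
move=> H e e0; have c0 : 0 < `|c| + 1 by rewrite ltr_wpDl.
have [d d0 Hd] := H _ (divr_gt0 e0 c0); exists d => // h /Hd hd.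
rewrite normrM; apply: (@le_trans _ _ ((`|c| + 1) * `|g h|)).
  by rewrite ler_wpM2r // lerDl.
by rewrite mulrC -ler_pdivlMr // mulrAC.
Qed.

Lemma little_oB (R : realType) (n : nat) (g1 g2 : R -> R) :
  little_o n g1 -> little_o n g2 -> little_o n (fun h => g1 h - g2 h).
Proof.
move=> H1 H2; apply: eq_little_o (little_oD H1 (little_oZ (-1) H2)) => h.
by rewrite mulN1r.
Qed.

Lemma little_o_sum (R : realType) (n : nat) (I : Type) (r : seq I)
    (g : I -> R -> R) :
  (forall i, little_o n (g i)) -> little_o n (fun h => \sum_(i <- r) g i h).
Proof.
move=> H; elim: r => [|i r IH].
  by apply: eq_little_o (@little_o0 _ _) => h; rewrite big_nil.
by apply: eq_little_o (little_oD (H i) IH) => h; rewrite big_cons.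
Qed.

Lemma little_o_scale (R : realType) (n : nat) (y : R) (g : R -> R) :
  little_o n g -> little_o n (fun h => g (y * h)).
Proof.
move=> H e e0; have c0 : 0 < `|y| + 1 by rewrite ltr_wpDl.
have [d d0 Hd] := H _ (divr_gt0 e0 (exprn_gt0 n c0)).
exists (d / (`|y| + 1)); first exact: divr_gt0.
move=> h; rewrite ltr_pdivlMr // => hd.
have le1 : `|y * h| <= `|h| * (`|y| + 1).
  by rewrite normrM mulrC ler_wpM2l // lerDl.
apply: le_trans (Hd _ (le_lt_trans le1 hd)) _.
rewrite mulrAC ler_pdivrMr ?exprn_gt0 // -mulrA ler_wpM2l ?(ltW e0) //.
by rewrite -exprMn lerXn2r // nnegrE mulr_ge0 // ltW.
Qed.

Lemma little_oW (R : realType) (n m : nat) (g : R -> R) :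
  (m <= n)%N -> little_o n g -> little_o m g.
Proof.
move=> mn H e e0; have [d d0 Hd] := H _ e0.
exists (Num.min d 1); first by rewrite lt_min d0 /=.
move=> h; rewrite lt_min => /andP[/Hd hd h1]; apply: le_trans hd _.
by rewrite ler_wpM2l ?(ltW e0) // ler_wiXn2l // ltW.
Qed.

Lemma little_oXn (R : realType) (n m : nat) :
  (m < n)%N -> little_o m (fun h : R => h ^+ n).
Proof.
move=> mn; apply: (@little_oW _ n.-1); first by case: n mn.
move=> e e0; exists e => // h he; rewrite normrX -(ltn_predK mn) exprS.
by rewrite ler_wpM2r ?exprn_ge0 // ltW.
Qed.

(* Iterating [|u h| <= |r|^-j (|u (r h)| + e |h|^n)] gives a geometric series
   of ratio [|r|^(n - j) < 1] plus the remainder [|r|^(-j N) |u (r^N h)|], which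
   tends to [0] because [u = o(h^j)]. *)
Lemma little_o_contract (R : realType) (n j : nat) (r : R) (u : R -> R) :
  0 < `|r| < 1 -> (j < n)%N -> little_o j u ->
  little_o n (fun h => u (r * h) - r ^+ j * u h) -> little_o n u.
Proof.
move=> /andP[r0 r1] jn uj un e e0.
set a := `|r| ^+ j; have a0 : 0 < a by rewrite exprn_gt0.
have r1' : 0 < 1 - `|r| by rewrite subr_gt0.
(* This [K] gives [e / K + e * |r|^n <= a * e], because [|r|^n <= a * |r|]; the term [e * |h|^n]
   thus reproduces itself in the induction. *)
pose K := (a * (1 - `|r|))^-1.
have K0 : 0 < K by rewrite invr_gt0 mulr_gt0.
have aK : a * K * (1 - `|r|) = 1.
  by rewrite mulrAC divff // mulf_neq0 ?gt_eqF.
have ae : 0 < e / K by rewrite divr_gt0.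
have [d d0 Hd] := un _ ae; exists d => // h hd.
have iterK N : `|u h| <= e * `|h| ^+ n + (a ^+ N)^-1 * `|u (r ^+ N * h)|.
  elim: N h hd => [|N IH] h hd.
    by rewrite expr0 invr1 !mul1r lerDr mulr_ge0 ?exprn_ge0 // ltW.
  have rhd : `|r * h| < d.
    by apply: le_lt_trans hd; rewrite normrM ler_piMl // ltW.
  have {IH}IH := IH _ rhd; have {}Hd := Hd _ hd.
  rewrite mulrA -exprSr in IH.
  have Ha : a * `|u h| <= e / K * `|h| ^+ n + `|u (r * h)|.
    rewrite /a -normrX -normrM.
    have -> : r ^+ j * u h = u (r * h) - (u (r * h) - r ^+ j * u h) by ring.
    by apply: le_trans (ler_normB _ _) _; rewrite addrC lerD2r.
  rewrite -(ler_pM2l a0); apply: le_trans Ha _.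
  have -> : a * (e * `|h| ^+ n + (a ^+ N.+1)^-1 * `|u (r ^+ N.+1 * h)|)
      = a * e * `|h| ^+ n + (a ^+ N)^-1 * `|u (r ^+ N.+1 * h)|.
    by rewrite exprS; field; rewrite !gt_eqF ?exprn_gt0.
  apply: le_trans (lerD (lexx _) IH) _; rewrite addrA lerD2r.
  rewrite normrM exprMn mulrA -mulrDl ler_wpM2r ?exprn_ge0 //.
  have -> : e / K = e * (a * (1 - `|r|)) by rewrite /K invrK.
  rewrite -mulrDr -[in leRHS](mulrC e) ler_wpM2l ?(ltW e0) //.
  have : `|r| ^+ n <= a * `|r|.
    by rewrite /a -exprSr ler_wiXn2l // ltW.
  lra.
(* With [h] fixed, [N] may depend on [h]. The estimate [u = o(h^j)] yields a factor [a^N] that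
   cancels [(a^N)^-1], so the remainder is at most [t]. *)
apply/ler_addgt0Pr => t t0.
have h1 : 0 < `|h| ^+ j + 1 by rewrite ltr_wpDl ?exprn_ge0.
have [d' d'0 Hd'] := uj _ (divr_gt0 t0 h1).
have [N HN] : exists N, `|r ^+ N * h| < d'.
  have rN : (fun N => r ^+ N * h) @ \oo --> 0 * h.
    by apply: cvgMr_tmp; exact: cvg_expr.
  rewrite mul0r in rN; move/cvgrPdist_lt/(_ _ d'0): rN => [N _ /(_ N (leqnn _))].
  by rewrite /= sub0r normrN; exists N.
apply: le_trans (iterK N) _; rewrite lerD2l.
rewrite mulrC ler_pdivrMr ?exprn_gt0 //; apply: le_trans (Hd' _ HN) _.
have -> : `|r ^+ N * h| ^+ j = a ^+ N * `|h| ^+ j.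
  by rewrite normrM exprMn normrX exprAC.
rewrite mulrAC ler_pdivrMr // -mulrA ler_wpM2l ?(ltW t0) //.
by rewrite ler_wpM2l ?lerDl // exprn_ge0 // ltW.
Qed.

Lemma little_o_qstep (R : realType) (n j : nat) (q : R) (u : R -> R) :
  q != 0 -> `|q| != 1 -> (j < n)%N -> little_o j u ->
  little_o n (fun h => u (q * h) - q ^+ j * u h) -> little_o n u.
Proof.
move=> q0 q1 jn uj un; have [ql1|qg1] := ltP `|q| 1.
  by apply: little_o_contract uj un => //; rewrite normr_gt0 q0.
apply: (@little_o_contract _ _ j q^-1) => //.
  by rewrite normfV invr_gt0 normr_gt0 q0 invf_lt1 ?normr_gt0 // lt_neqAle eq_sym q1.
(* Replacing [h] by [q^-1 h] and dividing by [- q^j] turns the hypothesis for [q] into the one for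
   [q^-1]. *)
apply: eq_little_o (little_oZ (- (q ^+ j)^-1) (little_o_scale q^-1 un)) => h.
rewrite mulrA divff // mul1r exprVn; field; exact: expf_neq0.
Qed.

(** * Polynomials in the dilation *)

(** With [v k = g (q^k h)], this moves a factor [X - a] of the polynomial onto the function, as
    [(T - a) g]. *)
Lemma sum_coef_mulXsubC (R : realType) (N : nat) (p : {poly R}) (a : R)
    (v : nat -> R) :
  (size p <= N)%N ->
  \sum_(k < N.+1) (p * ('X - a%:P))`_k * v k
    = \sum_(k < N) p`_k * (v k.+1 - a * v k).
Proof.
move=> pN; have E k : (p * ('X - a%:P))`_k = (p * 'X)`_k - p`_k * a.
  by rewrite mulrBr coefB coefMC.
under eq_bigr => k _ do rewrite E mulrBl.
under [RHS]eq_bigr => k _ do rewrite mulrBr.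
rewrite !sumrB; congr (_ - _).
  rewrite big_ord_recl coefMX /= mul0r add0r.
  by apply: eq_bigr => k _; rewrite coefMX.
rewrite big_ord_recr /= [p`_N]nth_default // !mul0r addr0.
by apply: eq_bigr => k _; rewrite mulrA.
Qed.

(* In terms of the dilation [T g h = g (q h)], the hypothesis says that
   [prod_(j in e) (T - q^j) g = o(h^n)]. *)
Lemma little_o_qprod (R : realType) (n : nat) (q : R) (e : seq nat)
    (g : R -> R) :
  let p := \prod_(j <- e) ('X - (q ^+ j)%:P) in
  q != 0 -> `|q| != 1 ->
  (forall j, j \in e -> (j < n)%N /\ little_o j g) ->
  little_o n (fun h => \sum_(k < (size e).+1) p`_k * g (q ^+ k * h)) ->
  little_o n g.
Proof.
move=> p q0 q1; rewrite {}/p; elim: e g => [|j e IH] g He.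
  apply: eq_little_o => h.
  by rewrite big_nil big_ord1 coef1 mul1r expr0 mul1r.
rewrite big_cons mulrC => Hp.
have [jn gj] : (j < n)%N /\ little_o j g by apply: He; rewrite inE eqxx.
(* The induction hypothesis is used for [(T - q^j) g], which is still [o(h^i)] for each remaining
   exponent [i]. *)
apply: (little_o_qstep q0 q1 jn gj); apply: IH => [i ie|].
  have [|iN gi] := He i; first by rewrite inE ie orbT.
  split=> //; apply: little_oB; first exact: little_o_scale.
  exact: little_oZ.
apply: eq_little_o Hp => h /=.
rewrite (sum_coef_mulXsubC _ (fun k => g (q ^+ k * h))).
  by apply: eq_bigr => k _; rewrite exprS mulrA.
by rewrite size_prod_XsubC.
Qed.

Lemma inj_exprn (R : realType) (q : R) :
  q != 0 -> `|q| != 1 -> injective (fun k : nat => q ^+ k).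
Proof.
move=> q0 q1; have H (i k : nat) : q ^+ i = q ^+ (i + k) -> k = 0%N.
  move/eqP; rewrite exprD -[X in X == _]mulr1 (inj_eq (mulfI _)) ?expf_neq0 //.
  move=> /eqP/(congr1 Num.norm); rewrite normr1 normrX => /esym/eqP.
  by rewrite pexprn_eq1 // (negbTE q1) orbF => /eqP.
move=> i k /= E; case: (leqP i k) => ik.
  by move: E; rewrite -(subnKC ik) => /H ->; rewrite addn0.
by move: E; rewrite -(subnKC (ltnW ik)) => /esym/H ->; rewrite addn0.
Qed.

(** The polynomial with coefficients [A k] has degree exactly [m], and annihilation of [h^j] says
    that [q^j] is a root. These [m] distinct roots factor it completely, up to the constant
    [A m]. *)
Lemma little_o_qdifference (R : realType) (n m : nat) (q : R) (e : seq nat)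
    (A : nat -> R) (g : R -> R) :
  q != 0 -> `|q| != 1 -> uniq e -> size e = m -> A m != 0 ->
  (forall j, j \in e -> (j < n)%N /\ little_o j g) ->
  (forall j, j \in e -> \sum_(k < m.+1) A k * (q ^+ k) ^+ j = 0) ->
  little_o n (fun h => \sum_(k < m.+1) A k * g (q ^+ k * h)) ->
  little_o n g.
Proof.
move=> q0 q1 ue se Am He HA Hg.
pose p := \poly_(k < m.+1) A k.
have sp : size p = m.+1 by rewrite size_poly_eq.
have pE : p = A m *: \prod_(j <- e) ('X - (q ^+ j)%:P).
  rewrite -(big_map (fun j => q ^+ j) xpredT (fun z => 'X - z%:P)).
  have -> : A m = lead_coef p by rewrite lead_coefE sp coef_poly ltnSn.
  apply: all_roots_prod_XsubC; first by rewrite size_map se.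
    apply/allP => _ /mapP[j je ->]; apply/rootP.
    by rewrite horner_poly -[RHS](HA _ je); apply: eq_bigr => k _; rewrite exprAC.
  by rewrite uniq_rootsE map_inj_uniq //; exact: inj_exprn.
apply: (@little_o_qprod _ n q e) => //.
apply: eq_little_o (little_oZ (A m)^-1 Hg) => h.
rewrite se big_distrr; apply: eq_bigr => k _ /=.
have -> : A k = p`_k by rewrite coef_poly ltn_ord.
by rewrite pE coefZ !mulrA mulVf // mul1r.
Qed.

(** * Weights of a difference without excess *)

(** Weights are functions of the node rather than of its index, so that [w (- y)] and [w y] can be
    compared in the symmetric case. *)
Definition node_weights (R : realType) (n : nat) (s : seq R) (w : R -> R)
    : Prop :=
  forall j, (j <= n)%N ->
    \sum_(y <- s) w y * y ^+ j = (j == n)%:R * n`!%:R.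

Lemma node_weights_horner (R : realType) (n : nat) (s : seq R) (w : R -> R)
    (p : {poly R}) (h : R) :
  node_weights n s w -> (size p <= n.+1)%N ->
  \sum_(y <- s) w y * p.[y * h] = p`_n * n`!%:R * h ^+ n.
Proof.
move=> Hw sp; under eq_bigr => y _ do rewrite (horner_coef_wide _ sp) mulr_sumr.
rewrite exchange_big /=.
transitivity (\sum_(i < n.+1) p`_i * h ^+ i * ((i == n :> nat)%:R * n`!%:R)).
  apply: eq_bigr => i _; rewrite -(Hw i) ?leq_ord // mulr_sumr.
  by apply: eq_bigr => y _; rewrite exprMn; ring.
rewrite big_ord_recr /= eqxx big1 ?add0r; first by rewrite mul1r mulrAC.
by move=> i _; rewrite ltn_eqF // mul0r mulr0.
Qed.

(** Uniqueness of the weights: [v] is tested on the product of [X - z] over the nodes [z] other than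
    [y], which among the nodes is nonzero only at [y]. *)
Lemma annihilator_nodes (R : realType) (n : nat) (s : seq R) (v : R -> R) :
  uniq s -> size s = n.+1 ->
  (forall j, (j <= n)%N -> \sum_(y <- s) v y * y ^+ j = 0) ->
  forall y, y \in s -> v y = 0.
Proof.
move=> us ss Hv y ys; pose p := \prod_(z <- rem y s) ('X - z%:P).
have sp : size p = n.+1 by rewrite size_prod_XsubC size_rem // ss.
have : \sum_(z <- s) v z * p.[z] = 0.
  under eq_bigr => z _ do rewrite horner_coef sp mulr_sumr.
  rewrite exchange_big /= big1 // => i _.
  transitivity (p`_i * \sum_(z <- s) v z * z ^+ i).
    by rewrite mulr_sumr; apply: eq_bigr => z _; ring.
  by rewrite Hv ?mulr0 // leq_ord.
rewrite (bigD1_seq y) //= big_seq_cond big1 ?addr0.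
  move/eqP; rewrite mulf_eq0 => /orP[/eqP //|].
  by rewrite -rootE root_prod_XsubC mem_rem_uniqF.
move=> z /andP[zs zy]; rewrite (_ : p.[z] = 0) ?mulr0 //; apply/rootP.
by rewrite root_prod_XsubC mem_rem_uniq // inE zy.
Qed.

(** The monic polynomial of degree [n] vanishing at all nodes but [y] has difference [n!], and only
    the term of [y] contributes to it. *)
Lemma node_weights_neq0 (R : realType) (n : nat) (s : seq R) (w : R -> R) :
  uniq s -> size s = n.+1 -> node_weights n s w ->
  forall y, y \in s -> w y != 0.
Proof.
move=> us ss Hw y ys; pose p := \prod_(z <- rem y s) ('X - z%:P).
have sp : size p = n.+1 by rewrite size_prod_XsubC size_rem // ss.
have := node_weights_horner 1 Hw (eq_leq sp).
under eq_bigr => z _ do rewrite mulr1.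
have -> : p`_n = 1.
  by have := monic_prod_XsubC (rem y s) xpredT id; rewrite monicE lead_coefE sp => /eqP.
rewrite (bigD1_seq y) //= big_seq_cond big1 ?addr0.
  move=> E; apply/eqP => wy; move: E; rewrite wy mul0r expr1n mulr1 mul1r.
  by move/esym/eqP; rewrite pnatr_eq0 eqn0Ngt fact_gt0.
move=> z /andP[zs zy]; rewrite (_ : p.[z] = 0) ?mulr0 //; apply/rootP.
by rewrite root_prod_XsubC mem_rem_uniq // inE zy.
Qed.

(* By Lagrange interpolation, the weights are [n!] times the leading
   coefficients of the Lagrange basis of the nodes. *)
Lemma node_weights_exist (R : realType) (n : nat) (s : seq R) :
  uniq s -> size s = n.+1 -> exists w : R -> R, node_weights n s w.
Proof.
move=> us ss; pose M (y : R) := \prod_(z <- rem y s) ('X - z%:P).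
have sM y : y \in s -> size (M y) = n.+1.
  by move=> ys; rewrite size_prod_XsubC size_rem // ss.
have My y : y \in s -> (M y).[y] != 0.
  by move=> ys; rewrite -rootE root_prod_XsubC mem_rem_uniqF.
have Mz y z : z \in s -> z != y -> (M y).[z] = 0.
  by move=> zs zy; apply/rootP; rewrite root_prod_XsubC mem_rem_uniq // inE zy.
exists (fun y => n`!%:R / (M y).[y]) => j jn.
(* [Q] is the interpolation error of [X^j]: its degree is at most [n] and it has [n + 1] roots, so
   it vanishes. Its coefficient of degree [n] then gives the moment condition. *)
pose Q := 'X^j - \sum_(y <- s) (y ^+ j / (M y).[y]) *: M y.
have sQ : (size Q <= n.+1)%N.
  apply: (leq_trans (size_polyD _ _)); rewrite geq_max size_polyXn ltnS jn.
  rewrite size_polyN big_seq; apply: (leq_trans (size_sum _ _ _)).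
  apply/bigmax_leqP_seq => y ys _; apply: leq_trans (size_scale_leq _ _) _.
  by rewrite sM.
have Q0 : Q = 0.
  apply/eqP; apply: contraT => Q0.
  have := max_poly_roots Q0 _ us; rewrite ss => /(_ _)/leq_trans/(_ sQ).
  rewrite ltnn => -> //; apply/allP => y ys; apply/rootP.
  rewrite hornerD hornerN hornerXn horner_sum (bigD1_seq y) //= hornerZ.
  rewrite divfK ?My // big_seq_cond big1 ?addr0 ?subrr // => z /andP[zs zy].
  by rewrite hornerZ (Mz z y) ?mulr0 // eq_sym.
have := congr1 (fun p : {poly R} => p`_n) Q0; rewrite /Q /=.
rewrite coefB coefXn coef0 coef_sum => /eqP; rewrite subr_eq0 [n == j]eq_sym => /eqP ->.
rewrite mulr_suml big_seq [RHS]big_seq; apply: eq_bigr => y ys.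
rewrite coefZ; have -> : (M y)`_n = 1.
  have := monic_prod_XsubC (rem y s) xpredT id.
  by rewrite -/(M y) monicE lead_coefE sM // => /eqP.
ring.
Qed.

(** * Expansions and node derivatives, in terms of little-o *)

(** The estimate at [h = 0] encodes the condition on the constant term: it gives [p.[0] = F 0]. *)
Definition has_taylor (R : realType) (n : nat) (F : R -> R) : Prop :=
  exists2 p : {poly R}, (size p <= n.+1)%N & little_o n (fun h => F h - p.[h]).

Lemma expansion_poly (R : realType) (n : nat) (c : 'I_n.+1 -> R) :
  exists2 p : {poly R}, (size p <= n.+1)%N &
    forall h, p.[h] = \sum_(i < n.+1) c i * (h ^+ i / i`!%:R).
Proof.
exists (\poly_(i < n.+1) (c (inord i) / i`!%:R)); first exact: size_poly.
move=> h; rewrite horner_poly; apply: eq_bigr => i _.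
by rewrite inord_val mulrAC mulrA.
Qed.

Lemma poly_expansion (R : realType) (n : nat) (p : {poly R}) :
  (size p <= n.+1)%N -> forall h,
  p.[h] = \sum_(i < n.+1) (p`_i * i`!%:R) * (h ^+ i / i`!%:R).
Proof.
move=> sp h; rewrite (horner_coef_wide _ sp); apply: eq_bigr => i _.
by field; rewrite pnatr_eq0 -lt0n fact_gt0.
Qed.

Lemma expansion_at0 (R : realType) (n : nat) (c : 'I_n.+1 -> R) :
  \sum_(i < n.+1) c i * (0 ^+ i / i`!%:R) = c ord0.
Proof.
rewrite big_ord_recl expr0 fact0 divr1 mulr1 big1 ?addr0 // => i _.
by rewrite expr0n mul0r mulr0.
Qed.

Lemma peano_existsE (R : realType) (n : nat) (f : R -> R) (x : R) :
  peano_exists n f x <-> has_taylor n (fun h => f (x + h)).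
Proof.
split=> [[c [c0 /eqo_little_o H]]|[p sp H]].
  have [p sp pE] := expansion_poly c; exists p => //.
  by apply: eq_little_o H => h; rewrite pE.
exists (fun i => p`_i * i`!%:R); split.
  have /eqP := little_o_at0 H.
  by rewrite (poly_expansion sp) expansion_at0 addr0 subr_eq0 => /eqP.
by apply/eqo_little_o; apply: eq_little_o H => h; rewrite (poly_expansion sp).
Qed.

(** The even part of [F] for even [n], the odd part for odd [n]. *)
Definition parity_part (R : realType) (n : nat) (F : R -> R) (h : R) : R :=
  2^-1 * (F h + (-1) ^+ n * F (- h)).

Lemma sym_peano_existsE (R : realType) (n : nat) (f : R -> R) (x : R) :
  sym_peano_exists n f x
    <-> has_taylor n (parity_part n (fun h => f (x + h))).
Proof.
split=> [[c [c0 /eqo_little_o H]]|[p sp H]].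
  have [p sp pE] := expansion_poly c; exists p => //.
  by apply: eq_little_o H => h; rewrite pE.
exists (fun i => p`_i * i`!%:R); split.
  move=> en; have /eqP := little_o_at0 H.
  rewrite (poly_expansion sp) expansion_at0 subr_eq0 => /eqP <-.
  rewrite /parity_part oppr0 addr0 -signr_odd (negbTE en) expr0; lra.
by apply/eqo_little_o; apply: eq_little_o H => h; rewrite (poly_expansion sp).
Qed.

(** The limit ignores [h = 0] while [little_o] does not; [phi 0 = 0] and [0 < n] settle that
    point. *)
Lemma cvg_div_little_o (R : realType) (n : nat) (phi : R -> R) (L : R) :
  (0 < n)%N -> phi 0 = 0 ->
  (phi h / h ^+ n @[h --> (0 : R)^'] --> L)
    <-> little_o n (fun h => phi h - L * h ^+ n).
Proof.
move=> n0 phi0; split=> [/cvgrPdist_le H e e0|H].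
  have : \forall h \near (0 : R), h != 0 -> `|L - phi h / h ^+ n| <= e.
    by have := H _ e0; rewrite near_withinE.
  move=> /nbhs_norm0P [d /= d0 Hd].
  exists d => // h hd; have [->|h0] := eqVneq h 0.
    by rewrite phi0 expr0n gtn_eqF //= mulr0 subr0 normr0 expr0n gtn_eqF //= mulr0.
  have := Hd h hd h0; rewrite distrC.
  have -> : phi h / h ^+ n - L = (phi h - L * h ^+ n) / h ^+ n.
    by field; rewrite expf_neq0.
  by rewrite normf_div normrX ler_pdivrMr // exprn_gt0 // normr_gt0.
apply/cvgrPdist_le => e e0; have [d d0 Hd] := H _ e0.
rewrite near_withinE.
suff : \forall h \near (0 : R), h != 0 -> `|L - phi h / h ^+ n| <= e by [].
apply/nbhs_norm0P; exists d => //= h hd h0.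
rewrite distrC.
have -> : phi h / h ^+ n - L = (phi h - L * h ^+ n) / h ^+ n.
  by field; rewrite expf_neq0.
by rewrite normf_div normrX ler_pdivrMr ?Hd // exprn_gt0 // normr_gt0.
Qed.

Definition has_node_derivative (R : realType) (n : nat) (s : seq R)
    (F : R -> R) : Prop :=
  exists w L, node_weights n s w /\
    little_o n (fun h => \sum_(y <- s) w y * F (y * h) - L * h ^+ n).

Lemma node_weights_at0 (R : realType) (n : nat) (s : seq R) (w : R -> R)
    (c : R) :
  (0 < n)%N -> node_weights n s w -> \sum_(y <- s) w y * c = 0.
Proof.
move=> n0 /(_ 0 (leq0n n)); rewrite ltn_eqF // mul0r => H.
rewrite -mulr_suml; under eq_bigr => y _ do rewrite -[w y]mulr1 -(expr0 y).
by rewrite H mul0r.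
Qed.

Lemma gr_derivable_at_nodesE (R : realType) (n : nat) (s : seq R) (f : R -> R)
    (x : R) :
  (0 < n)%N -> uniq s -> size s = n.+1 ->
  gr_derivable_at_nodes n s f x
    <-> has_node_derivative n s (fun h => f (x + h)).
Proof.
move=> n0 us ss; split=> [[A [[Ane0 _ HA] HL]]|[w [L [Hw HL]]]].
  (* [w y] is the coefficient at the position of [y] in [s], with default [0] off [s]. *)
  pose w y := oapp A 0 (insub (index y s)).
  have sumE (F : R -> R) : \sum_(y <- s) w y * F y = \sum_(k < size s) A k * F s`_k.
    rewrite (big_nth 0) big_mkord; apply: eq_bigr => k _.
    by rewrite /w index_uniq // valK.
  have Hw : node_weights n s w.
    by move=> j jn; rewrite (sumE (fun y => y ^+ j)) HA.
  have [L HL'] := (cvg_ex _).1 HL.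
  exists w, L; split=> //.
  apply/(cvg_div_little_o L n0).
    under eq_bigr do rewrite mulr0; exact: node_weights_at0 Hw.
  set phi := (X in X @ _ --> _) in HL'; set psi := (X in X @ _ --> _).
  suff -> : psi = phi by [].
  by apply/funext => h; rewrite /psi (sumE (fun y => f (x + y * h))).
exists (fun k => w s`_k); split; first split.
- by move=> k; apply: (node_weights_neq0 us ss Hw); rewrite mem_nth.
- by move=> i k /eqP; rewrite nth_uniq // => /eqP/val_inj.
- by move=> j jn; rewrite -(Hw _ jn) [RHS](big_nth 0) big_mkord.
apply/cvg_ex; exists L; apply/(cvg_div_little_o L n0).
  rewrite /gr_difference; under eq_bigr do rewrite mulr0.
  by have := node_weights_at0 (f (x + 0)) n0 Hw; rewrite (big_nth 0) big_mkord.
by apply: eq_little_o HL => h; rewrite (big_nth 0) big_mkord.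
Qed.

Lemma has_taylorW (R : realType) (n m : nat) (F : R -> R) :
  (m <= n)%N -> has_taylor n F -> has_taylor m F.
Proof.
move=> mn [p sp H]; exists (take_poly m.+1 p); first exact: size_take_poly.
apply: (@eq_little_o _ _ (fun h => (F h - p.[h]) +
    \sum_(i <- index_iota m.+1 n.+1) p`_i * h ^+ i)).
  move=> h; rewrite (horner_coef_wide _ sp) (horner_coef_wide _ (size_take_poly _ _)).
  under [in RHS]eq_bigr => i _ do rewrite coef_take_poly ltn_ord.
  rewrite -(big_mkord xpredT (fun i => p`_i * h ^+ i)) (big_cat_nat (leq0n m.+1) (mn : (m < n.+1)%N)) /=.
  rewrite big_mkord; ring.
apply: little_oD; first exact: little_oW H.
(* The range condition is copied into the summand because [little_o_sum] asks for the estimate at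
   every index. *)
apply: (@eq_little_o _ _ (fun h => \sum_(i <- index_iota m.+1 n.+1)
    if (m < i)%N then p`_i * h ^+ i else 0)).
  by move=> h; rewrite big_nat [RHS]big_nat; apply: eq_bigr => i /andP[-> _].
apply: little_o_sum => i; case mi: (m < i)%N; last exact: little_o0.
exact/little_oZ/little_oXn.
Qed.

(** The polynomial contributes exactly its coefficient of degree [n] times [n! h^n]; the remainder
    stays [o(h^n)] under each dilation. *)
Lemma has_taylor_node_derivative (R : realType) (n : nat) (s : seq R)
    (F : R -> R) :
  uniq s -> size s = n.+1 -> has_taylor n F -> has_node_derivative n s F.
Proof.
move=> us ss [p sp H]; have [w Hw] := node_weights_exist us ss.
exists w, (p`_n * n`!%:R); split=> //.
apply: (@eq_little_o _ _ (fun h => \sum_(y <- s) w y * (F (y * h) - p.[y * h]))).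
  move=> h; rewrite -(node_weights_horner h Hw sp) -sumrB.
  by apply: eq_bigr => y _; rewrite mulrBr.
by apply: little_o_sum => y; apply: little_oZ; apply: (little_o_scale y H).
Qed.

(** Adding [(L / n!) X^n] to [p] absorbs the main term [L h^n] of the difference, and does not
    disturb approximations of order [m < n]. *)
Lemma node_residual (R : realType) (n : nat) (s : seq R) (w : R -> R)
    (F : R -> R) (L : R) (p : {poly R}) :
  node_weights n s w -> (size p <= n)%N ->
  little_o n (fun h => \sum_(y <- s) w y * F (y * h) - L * h ^+ n) ->
  exists P : {poly R},
    [/\ (size P <= n.+1)%N,
        little_o n (fun h => \sum_(y <- s) w y * (F (y * h) - P.[y * h])) &
        forall m, (m < n)%N -> little_o m (fun h => F h - p.[h]) ->
          little_o m (fun h => F h - P.[h])].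
Proof.
move=> Hw sp HL; pose P := p + (L / n`!%:R) *: 'X^n.
have n1 : n`!%:R != 0 :> R by rewrite pnatr_eq0 -lt0n fact_gt0.
have sP : (size P <= n.+1)%N.
  apply: leq_trans (size_polyD _ _) _; rewrite geq_max (leq_trans sp) //=.
  by apply: leq_trans (size_scale_leq _ _) _; rewrite size_polyXn.
exists P; split=> // [|m mn Hm].
  apply: eq_little_o HL => h.
  rewrite (_ : L * h ^+ n = P`_n * n`!%:R * h ^+ n).
    rewrite -(node_weights_horner h Hw sP) -sumrB.
    by apply: eq_bigr => y _; rewrite mulrBr.
  by rewrite coefD nth_default // coefZ coefXn eqxx mulr1 add0r divfK.
have := little_oB Hm (little_oZ (L / n`!%:R) (@little_oXn R _ _ mn)).
apply: eq_little_o => h.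
by rewrite /P hornerD hornerZ hornerXn opprD addrA.
Qed.

(** * The nonsymmetric nodes *)

Lemma sum_iota_ord (R : realType) (n : nat) (F : nat -> R) :
  \sum_(i <- iota 0 n) F i = \sum_(i < n) F i.
Proof. by rewrite -(big_mkord xpredT) /index_iota subn0. Qed.

Lemma qD_nodes_uniq (R : realType) (q : R) (n : nat) :
  q != 0 -> `|q| != 1 -> uniq (qD_nodes q n).
Proof.
move=> q0 q1; rewrite /= map_inj_uniq ?iota_uniq ?andbT; last exact: inj_exprn.
by apply/negP => /mapP[i _ /eqP]; rewrite eq_sym (negbTE (expf_neq0 _ q0)).
Qed.

Lemma qDbar_nodes_uniq (R : realType) (q : R) (n : nat) :
  q != 0 -> `|q| != 1 -> uniq (qDbar_nodes q n).
Proof.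
by move=> q0 q1; rewrite map_inj_uniq ?iota_uniq //; exact: inj_exprn.
Qed.

(** The residual vanishes at [0], so the node [0] drops out and [n + 1] powers of [q] remain. The
    [n] roots come from exponents [1] to [n]: for these [0^j = 0], so the weight at [0] leaves the
    moment condition too. *)
Lemma qD_nodes_taylor (R : realType) (q : R) (n : nat) (F : R -> R) :
  q != 0 -> `|q| != 1 -> has_taylor n F ->
  has_node_derivative n.+1 (qD_nodes q n.+1) F -> has_taylor n.+1 F.
Proof.
move=> q0 q1 [p sp Hp] [w [L [Hw HL]]].
have [P [sP HP /(_ n (ltnSn n) Hp) Pn]] := node_residual Hw sp HL.
exists P => //; have g0 := little_o_at0 Pn.
apply: (@little_o_qdifference _ _ n q (iota 1 n) (fun k => w (q ^+ k))) => //.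
- exact: iota_uniq.
- exact: size_iota.
- apply: (node_weights_neq0 _ _ Hw); first exact: qD_nodes_uniq.
    by rewrite /= size_map size_iota.
  by rewrite inE map_f ?orbT // mem_iota /=.
- move=> j; rewrite mem_iota => /andP[j1 jn]; split=> //.
  by apply: little_oW Pn; rewrite -ltnS.
- move=> j; rewrite mem_iota => /andP[j1 jn].
  have := Hw j (ltnW jn); rewrite (@ltn_eqF j n.+1) //.
  rewrite big_cons big_map sum_iota_ord expr0n gtn_eqF //.
  by rewrite mulr0 add0r mul0r.
apply: eq_little_o HP => h.
by rewrite big_cons big_map sum_iota_ord mul0r g0 mulr0 add0r.
Qed.

(** All nodes are powers of [q], so all exponents [0] to [n] supply roots, as many as the degree
    [n + 1]. *)
Lemma qDbar_nodes_taylor (R : realType) (q : R) (n : nat) (F : R -> R) :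
  q != 0 -> `|q| != 1 -> has_taylor n F ->
  has_node_derivative n.+1 (qDbar_nodes q n.+1) F -> has_taylor n.+1 F.
Proof.
move=> q0 q1 [p sp Hp] [w [L [Hw HL]]].
have [P [sP HP /(_ n (ltnSn n) Hp) Pn]] := node_residual Hw sp HL.
exists P => //.
apply: (@little_o_qdifference _ _ n.+1 q (iota 0 n.+1) (fun k => w (q ^+ k))) => //.
- exact: iota_uniq.
- exact: size_iota.
- apply: (node_weights_neq0 _ _ Hw); first exact: qDbar_nodes_uniq.
    by rewrite size_map size_iota.
  by rewrite map_f // mem_iota /=.
- move=> j; rewrite mem_iota => /andP[_ jn]; split=> //.
  by apply: little_oW Pn; rewrite -ltnS.
- move=> j; rewrite mem_iota => /andP[_ jn].
  have := Hw j (ltnW jn); rewrite (@ltn_eqF j n.+1) //.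
  by rewrite big_map sum_iota_ord mul0r.
by apply: eq_little_o HP => h; rewrite big_map sum_iota_ord.
Qed.

(** * Parity and the symmetric nodes *)

Lemma sum_oppr_nodes (R : realType) (s : seq R) (F : R -> R) :
  perm_eq [seq - y | y <- s] s -> \sum_(y <- s) F (- y) = \sum_(y <- s) F y.
Proof. by move=> ps; rewrite -[RHS](perm_big _ ps) big_map. Qed.

(** The [j]-th moment of [w (- y) - (-1)^n w y] is [(-1)^j - (-1)^n] times that of [w]. One of the
    two factors is always [0], so uniqueness of the weights applies. *)
Lemma node_weights_oppr (R : realType) (n : nat) (s : seq R) (w : R -> R) :
  uniq s -> size s = n.+1 -> perm_eq [seq - y | y <- s] s ->
  node_weights n s w -> forall y, y \in s -> w (- y) = (-1) ^+ n * w y.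
Proof.
move=> us ss ps Hw y ys; apply/eqP; rewrite -subr_eq0; apply/eqP.
apply: (annihilator_nodes (v := fun y => w (- y) - (-1) ^+ n * w y) us ss) ys.
move=> j jn; under eq_bigr => z _ do rewrite mulrBl.
rewrite sumrB.
have -> : \sum_(z <- s) w (- z) * z ^+ j = (-1) ^+ j * \sum_(z <- s) w z * z ^+ j.
  rewrite -(sum_oppr_nodes (fun z => w z * z ^+ j) ps) mulr_sumr.
  apply: eq_bigr => z _; rewrite [(- z) ^+ j]exprNn [RHS]mulrCA.
  by rewrite [X in _ = _ * X]mulrA -expr2 sqrr_sign mul1r.
have -> : \sum_(z <- s) (-1) ^+ n * w z * z ^+ j
    = (-1) ^+ n * \sum_(z <- s) w z * z ^+ j.
  by rewrite mulr_sumr; apply: eq_bigr => z _; rewrite mulrA.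
rewrite Hw //; have [->|_] := eqVneq j n; first by rewrite subrr.
by rewrite mul0r !mulr0 subrr.
Qed.

Lemma sum_parity_part (R : realType) (n : nat) (s : seq R) (w F : R -> R) :
  perm_eq [seq - y | y <- s] s ->
  (forall y, y \in s -> w (- y) = (-1) ^+ n * w y) ->
  forall h, \sum_(y <- s) w y * parity_part n F (y * h)
    = \sum_(y <- s) w y * F (y * h).
Proof.
move=> ps Hw h.
have E : \sum_(y <- s) (-1) ^+ n * (w y * F (- (y * h)))
    = \sum_(y <- s) w y * F (y * h).
  rewrite -[RHS](sum_oppr_nodes (fun y => w y * F (y * h)) ps).
  rewrite big_seq [RHS]big_seq; apply: eq_bigr => y ys.
  by rewrite Hw // mulNr mulrA.
transitivity (2^-1 * (\sum_(y <- s) w y * F (y * h)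
    + \sum_(y <- s) (-1) ^+ n * (w y * F (- (y * h))))).
  rewrite -big_split mulr_sumr; apply: eq_bigr => y _ /=.
  by rewrite /parity_part; ring.
by rewrite E; lra.
Qed.

Lemma has_node_derivative_parity_part (R : realType) (n : nat) (s : seq R)
    (F : R -> R) :
  uniq s -> size s = n.+1 -> perm_eq [seq - y | y <- s] s ->
  has_node_derivative n s (parity_part n F) <-> has_node_derivative n s F.
Proof.
move=> us ss ps.
by split=> -[w [L [Hw HL]]]; exists w, L; split=> //; apply: eq_little_o HL => h;
  rewrite (sum_parity_part _ ps) //; exact: node_weights_oppr Hw.
Qed.

Lemma parity_partK (R : realType) (n : nat) (F : R -> R) :
  parity_part n (parity_part n F) =1 parity_part n F.
Proof.
move=> h; rewrite /parity_part opprK.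
have : (-1) ^+ n * (-1) ^+ n = 1 :> R by rewrite -expr2 sqrr_sign.
move: ((-1) ^+ n) => c cc.
transitivity (2^-1 * (2^-1 * (F h + c * F (- h) + (c * c * F h + c * F (- h))))).
  by ring.
by rewrite cc; lra.
Qed.

Lemma parity_partN (R : realType) (n : nat) (F : R -> R) (h : R) :
  parity_part n F (- h) = (-1) ^+ n * parity_part n F h.
Proof.
rewrite /parity_part opprK.
have : (-1) ^+ n * (-1) ^+ n = 1 :> R by rewrite -expr2 sqrr_sign.
move: ((-1) ^+ n) => c cc.
transitivity (2^-1 * (c * c * F (- h) + c * F h)); last by ring.
by rewrite cc; ring.
Qed.

Lemma little_o_parity_part (R : realType) (n m : nat) (F : R -> R) :
  little_o m F -> little_o m (parity_part n F).
Proof.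
move=> H; apply: little_oZ; apply: little_oD => //; apply: little_oZ.
by apply: eq_little_o (little_o_scale (-1) H) => h; rewrite mulN1r.
Qed.

Lemma parity_part_horner (R : realType) (n : nat) (p : {poly R}) :
  exists2 p' : {poly R}, (size p' <= size p)%N &
    forall h, p'.[h] = parity_part n (horner p) h.
Proof.
exists (\poly_(i < size p) (2^-1 * (p`_i + (-1) ^+ n * ((-1) ^+ i * p`_i)))).
  exact: size_poly.
move=> h; rewrite horner_poly /parity_part !horner_coef [X in _ + X]mulr_sumr.
rewrite -big_split mulr_sumr; apply: eq_bigr => i _ /=.
by rewrite [(- h) ^+ i]exprNn; ring.
Qed.

Lemma qDs_nodes_size (R : realType) (q : R) (n : nat) :
  size (qDs_nodes q n) = n.+1.
Proof.
rewrite !size_cat !size_map !size_iota addnn.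
have := odd_double_half n.+1; rewrite /=.
by case: (odd n) => /= ->.
Qed.

Lemma qDs_nodes_uniq (R : realType) (q : R) (n : nat) :
  q != 0 -> `|q| != 1 -> uniq (qDs_nodes q n).
Proof.
move=> q0 q1; rewrite /qDs_nodes; set m := _./2.
have qn0 (i : nat) : (q ^+ i == 0) = false by apply/negbTE; rewrite expf_neq0.
have Npow : uniq [seq - q ^+ i | i <- iota 0 m].
  rewrite map_inj_uniq ?iota_uniq // => i k /oppr_inj; exact: inj_exprn.
have disj : ~~ has [in [seq q ^+ i | i <- iota 0 m]] [seq - q ^+ i | i <- iota 0 m].
  apply/hasPn => _ /mapP[i _ ->]; apply/negP => /= /mapP[k _ E].
  (* Absolute values identify the exponents; [q^i = - q^i] is then impossible. *)
  have ik : i = k.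
    apply: (@inj_exprn _ `|q|); rewrite ?normr_eq0 ?normr_id //=.
    by rewrite -!normrX -E normrN.
  move/eqP: E; rewrite ik eq_sym -subr_eq0 opprK -mulr2n mulrn_eq0.
  by rewrite qn0.
have Hcat : uniq ([seq q ^+ i | i <- iota 0 m] ++ [seq - q ^+ i | i <- iota 0 m]).
  rewrite cat_uniq Npow disj map_inj_uniq ?iota_uniq //; exact: inj_exprn.
case: odd => //=; rewrite Hcat andbT mem_cat negb_or.
apply/andP; split; apply/negP => /mapP[i _ /esym/eqP]; rewrite ?oppr_eq0 qn0 //.
Qed.

Lemma qDs_nodes_oppr (R : realType) (q : R) (n : nat) :
  perm_eq [seq - y | y <- qDs_nodes q n] (qDs_nodes q n).
Proof.
rewrite /qDs_nodes !map_cat -!map_comp.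
have -> : [seq - y | y <- if odd n then [::] else [:: 0]]
    = (if odd n then [::] else [:: 0]) :> seq R by case: odd; rewrite //= oppr0.
rewrite perm_cat2l perm_catC.
rewrite (_ : [seq (-%R \o (fun i => - q ^+ i)) i | i <- _]
  = [seq q ^+ i | i <- iota 0 (n.+1)./2]) //.
by apply: eq_map => i /=; rewrite opprK.
Qed.

(** Pairing opposite nodes leaves only powers of [q], the shape required by
    [little_o_qdifference]. *)
Lemma sum_qDs_nodes (R : realType) (q : R) (n : nat) (H : R -> R) :
  (~~ odd n -> H 0 = 0) ->
  (forall y, y \in qDs_nodes q n -> H (- y) = H y) ->
  \sum_(y <- qDs_nodes q n) H y = 2 * \sum_(i < (n.+1)./2) H (q ^+ i).
Proof.
move=> H0 HN; rewrite !big_cat !big_map !sum_iota_ord /=.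
have -> : \sum_(i <- if odd n then [::] else [:: 0]) H i = 0.
  by case: (odd n) H0 => [_|/(_ isT) H0]; rewrite ?big_nil // big_seq1.
rewrite add0r mulr_natl mulr2n; congr (_ + _); apply: eq_bigr => i _.
by apply: HN; rewrite !mem_cat [X in _ || (X || _)]map_f ?orbT // mem_iota /=.
Qed.

(** After pairing, [m + 1] powers of [q] remain, where [m + 1] is half of [n + 1] rounded down. The
    [m] roots come from [n - 2, n - 4, ...] down to [1] or [2], so an estimate of order [n - 2]
    covers them all. *)
Lemma qDs_nodes_taylor (R : realType) (q : R) (n : nat) (F : R -> R) :
  q != 0 -> `|q| != 1 -> (0 < n)%N ->
  ((2 <= n)%N -> has_taylor (n - 2) (parity_part n F)) ->
  has_node_derivative n (qDs_nodes q n) (parity_part n F) ->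
  has_taylor n (parity_part n F).
Proof.
move=> q0 q1 n0 HF [w [L [Hw HL]]].
have us := qDs_nodes_uniq n q0 q1; have ss := qDs_nodes_size q n.
have ps := qDs_nodes_oppr q n; have wN := node_weights_oppr us ss ps Hw.
set S := parity_part n F in HF HL *.
have [p sp Hp] : exists2 p : {poly R}, (size p <= n)%N &
    ((2 <= n)%N -> little_o (n - 2) (fun h => S h - p.[h])).
  case: (leqP 2 n) => [n2|_]; last by exists 0; rewrite ?size_poly0.
  by have [p sp Hp] := HF n2; exists p => //; apply: leq_trans sp _; lia.
have [P [sP HP Hm]] := node_residual Hw sp HL.
(* [P] may lack the parity of [n]; passing to its parity part [P'] gives a residual [G] that has
   it. *)
have [P' sP' P'E] := parity_part_horner n P.
exists P'; first exact: leq_trans sP' sP.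
pose G := parity_part n (fun h => S h - P.[h]).
have GE h : G h = S h - P'.[h].
  transitivity (parity_part n S h - parity_part n (horner P) h).
    by rewrite /G /parity_part; ring.
  by rewrite P'E; congr (_ - _); exact: parity_partK.
apply: (@eq_little_o _ _ G) => //.
have Gm : (2 <= n)%N -> little_o (n - 2) G.
  by move=> n2; apply/little_o_parity_part/Hm; [lia|exact: Hp].
have G0 : ~~ odd n -> G 0 = 0.
  by move=> en; apply: (@little_o_at0 _ (n - 2)); apply: Gm; case: (n) n0 en => [|[]].
have m0 : (0 < (n.+1)./2)%N by lia.
pose m := ((n.+1)./2).-1; have mE : (n.+1)./2 = m.+1 by rewrite prednK.
apply: (@little_o_qdifference _ _ m q [seq (n - 2 * i.+1)%N | i <- iota 0 m]
  (fun k => w (q ^+ k))) => //.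
- rewrite map_inj_in_uniq ?iota_uniq // => i k.
  by rewrite !mem_iota; lia.
- by rewrite size_map size_iota.
- apply: (node_weights_neq0 us ss Hw); rewrite !mem_cat [X in _ || (X || _)]map_f ?orbT //.
  by rewrite mem_iota mE /=.
- move=> k /mapP[i]; rewrite mem_iota => im ->; split; first lia.
  by apply: (@little_oW _ (n - 2)); [lia|apply: Gm; lia].
- move=> k /mapP[i]; rewrite mem_iota => im ->; set j := (n - 2 * i.+1)%N.
  (* Positivity of [j] makes the central node contribute [0]; the common parity of [j] and [n] makes
     [w y * y^j] even in [y]. *)
  have j0 : (0 < j)%N by rewrite /j; lia.
  have jn : (j < n)%N by rewrite /j; lia.
  have := Hw j (ltnW jn); rewrite ltn_eqF // mul0r sum_qDs_nodes.
  + by rewrite mE => /eqP; rewrite mulf_eq0 pnatr_eq0 => /eqP.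
  + by move=> _; rewrite expr0n gtn_eqF // mulr0.
  move=> y ys; rewrite wN // [(- y) ^+ j]exprNn.
  have -> : (-1) ^+ j = (-1) ^+ n :> R.
    by rewrite -signr_odd -[RHS]signr_odd; congr (_ ^+ (nat_of_bool _)); rewrite /j; lia.
  by rewrite mulrACA -expr2 sqrr_sign mul1r.
apply: eq_little_o (little_oZ 2^-1 HP) => h.
rewrite -(sum_parity_part (fun h => S h - P.[h]) ps wN) -/G.
rewrite (@sum_qDs_nodes _ _ _ (fun y => w y * G (y * h))) -?mE.
- by rewrite mulrA mulVf ?mul1r ?pnatr_eq0.
- by move=> en; rewrite mul0r G0 // mulr0.
move=> y ys; rewrite wN // mulNr /G parity_partN -/G.
by rewrite mulrACA -expr2 sqrr_sign mul1r.
Qed.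

(** * Assembly of the two equivalences *)

Theorem theoremA (R : realType) (q : R) (hq0 : q <> 0) (hq1 : q <> 1)
  (hqN1 : q <> - 1) (n : nat) (hn : (0 < n)%N) (f : R -> R) (x : R) :
  ((peano_exists (n - 1) f x /\ (qD_exists q n f x \/ qDbar_exists q n f x))
     <-> peano_exists n f x)
  /\
  ((((2 <= n)%N -> sym_peano_exists (n - 2) f x) /\ qDs_exists q n f x)
     <-> sym_peano_exists n f x).
Proof.
have q0 : q != 0 by apply/eqP.
have q1 : `|q| != 1.
  by rewrite -sqr_norm_eq1 sqrf_eq1 negb_or; apply/andP; split; apply/eqP.
have uD := qD_nodes_uniq n q0 q1.
have uB := qDbar_nodes_uniq n q0 q1.
have uS := qDs_nodes_uniq n q0 q1.
have sD : size (qD_nodes q n) = n.+1 by rewrite /= size_map size_iota.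
have sB : size (qDbar_nodes q n) = n.+1 by rewrite size_map size_iota.
have sS := qDs_nodes_size q n.
split.
  rewrite !peano_existsE /qD_exists /qDbar_exists !gr_derivable_at_nodesE //.
  split=> [[Hf]|Hf].
    rewrite subn1 in Hf; rewrite -(prednK hn) => -[].
      exact: qD_nodes_taylor.
    exact: qDbar_nodes_taylor.
  split; first by apply: has_taylorW Hf; exact: leq_subr.
  by left; exact: has_taylor_node_derivative.
rewrite /qDs_exists gr_derivable_at_nodesE // !sym_peano_existsE.
(* Orders [n - 2] and [n] have the same parity, so both symmetric expansions concern the same part
   of [f]. *)
have parity2 : (2 <= n)%N ->
    parity_part (n - 2) (fun h => f (x + h)) = parity_part n (fun h => f (x + h)).
  move=> n2; apply/funext => h; rewrite /parity_part.
  by rewrite -[in RHS](subnK n2) exprD sqrrN expr1n mulr1.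
rewrite -(has_node_derivative_parity_part _ uS sS (qDs_nodes_oppr q n)).
split=> [[Hf HD]|Hf].
  by apply: qDs_nodes_taylor HD => // n2; rewrite -parity2 //; exact: Hf.
split; first by move=> n2; rewrite parity2 //; apply: has_taylorW Hf; exact: leq_subr.
exact: has_taylor_node_derivative.
Qed.
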